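(* Assume $q^{2d}\neq1$ for all integers $d\ge1$. Let $I=\{1,\dots,p\}$ and let $f\in H_I$ be an invariant element which is homogeneous of degree $n_i$ in $x_i,y_i$ for each $i\in I$. Then $$f=\sum_{k=0}^{n_1}\frac{\begin{bmatrix} n_1\\ k\end{bmatrix}\begin{bmatrix} n_2\\ k\end{bmatrix}}{\begin{bmatrix} n_1+n_2-k+1\\ k\end{bmatrix}}\,(12)^k\,P_{21}^{\,n_1-k}P_{12}^{\,n_1-k}\,\Omega_{12}^{\,k}f,$$ where the terms with $k>n_2$ (whose coefficient vanishes) are taken to be $0$.
   Context: Fix $q\in\mathbb C$ with $|q|=1$, $q\neq\pm1,\pm i$, and a square root $q^{1/2}$. $[m]=\frac{q^m-q^{-m}}{q-q^{-1}}$, $(m)=\frac{q^{2m}-1}{q^2-1}$, $[m]!=[1]\cdots[m]$, $\begin{bmatrix} n\\ k\end{bmatrix}=\frac{[n]!}{[n-k]![k]!}$. For $I=\{1,\dots,p\}$, $H_I$ is the unital associative $\mathbb C$-algebra generated by $x_i,y_i$ with relations $x_iy_i=qy_ix_i$ and, for $i<j$: $x_jx_i=q^2x_ix_j$, $y_jy_i=q^2y_iy_j$, $x_jy_i=qy_ix_j+(q^2-1)x_iy_j$, $y_jx_i=qx_iy_j$; PBW basis: ordered monomials $x_{a_1}^{i_1}y_{a_1}^{j_1}\cdots x_{a_r}^{i_r}y_{a_r}^{j_r}$, $a_1<\dots<a_r$. $U_q(gl(2,\mathbb R))$, generated by $E,F,K^{\pm1},L^{\pm1}$, acts on $H_I$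 by $L1=K1=1$, $E1=F1=0$, $Lx_i=q^{1/2}x_i$, $Ly_i=q^{1/2}y_i$, $Kx_i=q^{-1/2}x_i$, $Ky_i=q^{1/2}y_i$, $Ex_i=q^{1/2}y_i$, $Ey_i=0$, $Fx_i=0$, $Fy_i=q^{-1/2}x_i$, extended by $K(ab)=K(a)K(b)$, $L(ab)=L(a)L(b)$, $E(ab)=E(a)K(b)+K^{-1}(a)E(b)$, $F(ab)=F(a)K(b)+K^{-1}(a)F(b)$; $a$ is an invariant element (of degree $k$) if $Ea=Fa=0$, $Ka=a$, $La=q^{k/2}a$. $(ij):=q^{-1/2}x_iy_j-q^{1/2}y_ix_j$. For $k\neq l$, $\Delta_{kl}$ is the linear map defined on each PBW monomial, viewed as a word $z_1\cdots z_N$ in the generators, by $\Delta_{kl}(z_1\cdots z_N)=\sum_{r:\,z_r\in\{x_k,y_k\}}z_1\cdots z_{r-1}z_r'z_{r+1}\cdots z_N$ (product in $H_I$), $x_k'=x_l$, $y_k'=y_l$; $P_{kl}(a)=\frac1{(n_k)}\Delta_{kl}(a)$ for a PBW monomial $a$ of degree $n_k\ge1$ in $x_k,y_k$, extended linearly. Quantum $\Omega$-process: if $g$ is a linear combination of PBW monomials each of degree $m\ge1$ in $x_1,y_1$ and $n\ge1$ in $x_2,y_2$, there is a unique $a\in H_I$ with $g=P_{21}P_{12}g+(12)a$, and $\Omega_{12}(g):=\frac{[n+1]}{[n]}a$. *)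

(* Defs.v *)
From Stdlib Require Import ClassicalEpsilon.
From mathcomp Require Import all_boot all_algebra.
From mathcomp Require Export complex reals.
Set Implicit Arguments. Unset Strict Implicit. Unset Printing Implicit Defensive.
Import GRing.Theory Num.Theory.
Local Open Scope ring_scope.

Section QuantumOmega.
Variable R : realType.
Local Notation C := (R[i])%C.
Variable q : C.

Definition qint (m : nat) : C := (q ^+ m - q ^- m) / (q - q^-1).
Definition qpar (m : nat) : C := (q ^+ (2 * m) - 1) / (q ^+ 2 - 1).
Definition qfact (m : nat) : C := \prod_(1 <= i < m.+1) qint i.
Definition qbinom (n k : nat) : C := qfact n / (qfact (n - k) * qfact k).

Variable A : algType C.
Variables x y : nat -> A.
Variable p : nat.

Definition letter := (bool * nat)%type.
Definition ev (z : letter) : A := if z.1 then x z.2 else y z.2.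
Definition evw (w : seq letter) : A := \prod_(z <- w) ev z.

(* PBW monomials: exponents (i_a, j_a) for each a in I (ordinal a <-> index a+1) *)
Definition mono := {ffun 'I_p -> nat * nat}.
Definition word (e : mono) : seq letter :=
  flatten [seq nseq (e a).1 (true, (a : nat).+1) ++ nseq (e a).2 (false, (a : nat).+1)
          | a <- enum 'I_p].
Definition pbw (e : mono) : A := evw (word e).
Definition degk (k : nat) (e : mono) : nat := count (fun z : letter => z.2 == k) (word e).

Definition inI (i : nat) := (1 <= i <= p)%N.

Definition is_H_I : Prop :=
  [/\ (forall i, inI i -> x i * y i = q *: (y i * x i)),
      (forall i j, inI i -> inI j -> (i < j)%N ->
        [/\ x j * x i = q ^+ 2 *: (x i * x j),
            y j * y i = q ^+ 2 *: (y i * y j),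
            x j * y i = q *: (y i * x j) + (q ^+ 2 - 1) *: (x i * y j)
          & y j * x i = q *: (x i * y j)]),
      (forall a : A, exists (s : seq mono) (c : mono -> C),
          a = \sum_(e <- s) c e *: pbw e)
    &
      (forall (s : seq mono) (c : mono -> C), uniq s ->
          \sum_(e <- s) c e *: pbw e = 0 -> forall e, e \in s -> c e = 0)].

Definition homog (a : A) (n : nat -> nat) : Prop :=
  exists (s : seq mono) (c : mono -> C),
    a = \sum_(e <- s) c e *: pbw e /\
    forall e, e \in s -> forall i, inI i -> degk i e = n i.

Definition bihom12 (a : A) (m n : nat) : Prop :=
  exists (s : seq mono) (c : mono -> C),
    a = \sum_(e <- s) c e *: pbw e /\
    forall e, e \in s -> degk 1 e = m /\ degk 2 e = n.

Variable qh : C. (* chosen square root q^{1/2} *)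
Definition is_Uq_action (E F K Kinv L : {linear A -> A}) : Prop :=
  [/\ K 1 = 1 /\ L 1 = 1 /\ E 1 = 0 /\ F 1 = 0,
      (forall i, inI i ->
         [/\ L (x i) = qh *: x i, L (y i) = qh *: y i,
             K (x i) = qh^-1 *: x i, K (y i) = qh *: y i
           & [/\ E (x i) = qh *: y i, E (y i) = 0,
                 F (x i) = 0 & F (y i) = qh^-1 *: x i]]),
      (forall a, Kinv (K a) = a) /\ (forall a, K (Kinv a) = a),
      (forall a b, K (a * b) = K a * K b) /\ (forall a b, L (a * b) = L a * L b)
    & (forall a b, E (a * b) = E a * K b + Kinv a * E b) /\
      (forall a b, F (a * b) = F a * K b + Kinv a * F b)].

Definition is_invariant (E F K L : A -> A) (a : A) : Prop :=
  [/\ E a = 0, F a = 0, K a = a & exists k : nat, L a = qh ^+ k *: a].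

Definition Dword (k l : nat) (w : seq letter) : A :=
  \sum_(r < size w | (nth (true, 0%N) w r).2 == k)
     evw (set_nth (true, 0%N) w r ((nth (true, 0%N) w r).1, l)).

Definition is_P (k l : nat) (P : {linear A -> A}) : Prop :=
  forall e : mono, P (pbw e) = (qpar (degk k e))^-1 *: Dword k l (word e).

Definition w12 : A := qh^-1 *: (x 1 * y 2) - qh *: (y 1 * x 2).

(* quantum Omega-process: Omega_{12}(g) = [n+1]/[n] a where a is the (unique)
   element with g = P21 P12 g + (12) a, g bihomogeneous of degrees m,n >= 1 *)
Definition Omega12 (P12 P21 : A -> A) (g : A) : A :=
  epsilon (inhabits (0 : A)) (fun h => exists (m n : nat) (a : A),
     [/\ (1 <= m)%N, (1 <= n)%N, bihom12 g m n,
         g = P21 (P12 g) + w12 * a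
       & h = (qint n.+1 / qint n) *: a]).

End QuantumOmega.

(* Main.v *)
(** Write (n) for the quantum number [qnum q n], D and D' for the polarizations (m) P12 and
    (n) P21 on elements of bidegree (m, n), and w for (12).  On PBW monomials one checks that
    D w = q^2 w D, that D' w = w D', that D'D - DD' = (m) - (n), and that (m)(n+1) - D'D takes
    its values in the image of multiplication by w, which is injective.  So there is a sequence
    b_0 = f, b_1, b_2, ... with (m-k)(n-k+1) b_k = D'D b_k + w b_{k+1}, and b_k is a scalar
    multiple of Omega^k f.  By the commutation rules q^{2k} D b_k is such a sequence for D f;
    hence the expansion of f follows, by induction on m, from those of D f and of b_1, the
    coefficients being matched by (m)(n) = q^{2k} (m-k)(n-k) + (k)(m+n-k). *)
From Stdlib Require Import ClassicalEpsilon.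
From HB Require Import structures.
Require Import Defs.
From mathcomp Require Import all_boot all_algebra.
From mathcomp Require Import complex reals.
From mathcomp Require Import ring zify.
Import GRing.Theory Num.Theory.
Local Open Scope ring_scope.
Set Implicit Arguments. Unset Strict Implicit. Unset Printing Implicit Defensive.

(* [ring] and [field] do not normalise powers with symbolic exponents; these are split into
   powers with atomic exponents, which are then abstracted as nonzero field elements. *)
Ltac not_numeral n := lazymatch n with O => fail | S ?m => not_numeral m | _ => idtac end.
Ltac expand_pow :=
  repeat match goal with
  | |- context [GRing.exp ?a (muln 2 ?n)] =>
       rewrite [GRing.exp a (muln 2 n)](exprM a 2 n) (exprAC a 2 n)
               [GRing.exp (GRing.exp a n) 2]expr2
  | |- context [GRing.exp ?a (S ?n)] =>
       not_numeral n; rewrite [GRing.exp a (S n)](exprS a n)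
  | |- context [GRing.exp ?a (addn ?m ?n)] => rewrite [GRing.exp a (addn m n)](exprD a m n)
  end.
Ltac abstract_pow :=
  repeat match goal with
  | h0 : is_true (?a != 0) |- context [GRing.exp ?a ?n] => is_var n;
    let h := fresh in let t := fresh in
    have h := expf_neq0 n h0; set t := (GRing.exp a n) in h |- *; clearbody t
  end.
Ltac qfield := expand_pow; abstract_pow; field; rewrite ?andbT;
  repeat (apply/andP; split); try done.

(* The number (n) of the paper.  It is locked since unification otherwise unfolds it to a
   product when rewriting with module identities. *)
HB.lock Definition qnum (F : fieldType) (q : F) (n : nat) : F :=
  (q ^+ (2 * n) - 1) / (q ^+ 2 - 1).

Lemma qnumE (F : fieldType) (q : F) n : qnum q n = (q ^+ (2 * n) - 1) / (q ^+ 2 - 1).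
Proof. by rewrite unlock. Qed.

(** * Arithmetic of the one-sided quantum numbers *)

Section QuantumNumbers.
Variables (F : fieldType) (q : F).
Hypothesis q_not_root1 : forall d : nat, (1 <= d)%N -> q ^+ (2 * d) != 1.

Lemma q2_sub1_neq0 : q ^+ 2 - 1 != 0.
Proof. by rewrite subr_eq0 (@q_not_root1 1). Qed.

Lemma qnum0 : qnum q 0 = 0.
Proof. by rewrite qnumE muln0 expr0 subrr mul0r. Qed.

Lemma qnum_neq0 n : (0 < n)%N -> qnum q n != 0.
Proof.
by move=> n_gt0; rewrite qnumE mulf_neq0 ?invr_eq0 ?q2_sub1_neq0 // subr_eq0 q_not_root1.
Qed.

Lemma qnumSl n : q ^+ 2 - 1 != 0 -> qnum q n.+1 = 1 + q ^+ 2 * qnum q n.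
Proof. by move=> q2; rewrite !qnumE; expand_pow; field. Qed.

Lemma qnumSr n : q ^+ 2 - 1 != 0 -> qnum q n.+1 = q ^+ (2 * n) + qnum q n.
Proof. by move=> q2; rewrite !qnumE; expand_pow; field. Qed.

(** Removes the truncated exponent [n.-1]: at [n = 0] both sides vanish. *)
Lemma qnum_divX_pred n : q != 0 -> qnum q n / q ^+ n.-1 = qnum q n * q / q ^+ n.
Proof.
move=> q_neq0; case: n => [|n]; first by rewrite qnum0 !mul0r.
by rewrite exprS invfM mulrA mulfK.
Qed.

End QuantumNumbers.

(** * Two q-commuting quantum planes *)

Section QCommute.
Variables (F : fieldType) (A : algType F).

Lemma qcomm_expr (k : F) (u v : A) n :
  u * v = k *: (v * u) -> u * v ^+ n = k ^+ n *: (v ^+ n * u).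
Proof.
move=> uv; elim: n => [|n IHn]; first by rewrite !expr0 mulr1 mul1r scale1r.
by rewrite [v ^+ _]exprS mulrA uv -scalerAl -[v * u * _]mulrA IHn -scalerAr scalerA !mulrA -!exprS.
Qed.

Lemma qcomm_exprl (k : F) (u v : A) n :
  u * v = k *: (v * u) -> u ^+ n * v = k ^+ n *: (v * u ^+ n).
Proof.
move=> uv; elim: n => [|n IHn]; first by rewrite !expr0 mulr1 mul1r scale1r.
by rewrite [u ^+ _]exprS -mulrA IHn -scalerAr [u * (v * _)]mulrA uv -scalerAl scalerA -mulrA -exprSr.
Qed.

Lemma qcomm_sym (k : F) (u v : A) : k != 0 -> u * v = k *: (v * u) -> v * u = k^-1 *: (u * v).
Proof. by move=> k0 ->; rewrite scalerA mulVf // scale1r. Qed.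

End QCommute.

Section TwoQuantumPlanes.
Variables (F : fieldType) (q : F) (A : algType F) (x1 y1 x2 y2 : A).
Hypothesis q_neq0 : q != 0.
Hypothesis q_not_root1 : forall d : nat, (1 <= d)%N -> q ^+ (2 * d) != 1.
Hypothesis xy1 : x1 * y1 = q *: (y1 * x1).
Hypothesis xy2 : x2 * y2 = q *: (y2 * x2).
Hypothesis x2x1 : x2 * x1 = q ^+ 2 *: (x1 * x2).
Hypothesis y2y1 : y2 * y1 = q ^+ 2 *: (y1 * y2).
Hypothesis x2y1 : x2 * y1 = q *: (y1 * x2) + (q ^+ 2 - 1) *: (x1 * y2).
Hypothesis y2x1 : y2 * x1 = q *: (x1 * y2).

Local Notation "[ n ]" := (qnum q n) (format "[ n ]").

Definition mon4 a b c d : A := x1 ^+ a * (y1 ^+ b * (x2 ^+ c * y2 ^+ d)).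

(** Each passage of [x2] across a [y1] leaves a correction in [x1 * y2]; in PBW order the
    corrections form a geometric sum. The truncated [b.-1] is harmless, its coefficient being zero
    at [b = 0]. *)
Lemma x2_y1n b :
  x2 * y1 ^+ b = q ^+ b *: (y1 ^+ b * x2) + (q ^+ (2 * b) - 1) *: (x1 * (y1 ^+ b.-1 * y2)).
Proof.
elim: b => [|b IHb]; first by rewrite muln0 !expr0 subrr scale0r addr0 scale1r mulr1 mul1r.
rewrite {1}exprSr mulrA IHb mulrDl -!scalerAl -!mulrA x2y1 y2y1 mulrDr -!scalerAr.
rewrite scalerDr !scalerA -addrA [y1 ^+ b * (y1 * _)]mulrA -exprSr -[q ^+ b * q]exprSr.
congr (_ + _); rewrite succnK.
have yx : y1 ^+ b * (x1 * y2) = (q ^+ b)^-1 *: (x1 * (y1 ^+ b * y2)).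
  by rewrite mulrA (qcomm_exprl b (qcomm_sym q_neq0 xy1)) exprVn -scalerAl !mulrA.
rewrite yx scalerA; case: b {IHb yx} => [|b].
  by rewrite muln0 !expr0 subrr mul0r scale0r addr0 !mul1r invr1 mulr1.
rewrite succnK [y1 ^+ b * _]mulrA -exprSr -mulrA -scalerDl; congr (_ *: _); qfield.
Qed.

Lemma x2n_y1 c :
  x2 ^+ c * y1 = q ^+ c *: (y1 * x2 ^+ c) + (q ^+ (2 * c) - 1) *: (x1 * (x2 ^+ c.-1 * y2)).
Proof.
elim: c => [|c IHc]; first by rewrite muln0 !expr0 subrr scale0r addr0 scale1r mulr1 mul1r.
rewrite exprS -mulrA IHc mulrDr -!scalerAr [x2 * (y1 * _)]mulrA x2y1 mulrDl -!scalerAl.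
rewrite [x2 * (x1 * _)]mulrA x2x1 -scalerAl !scalerDr !scalerA -addrA -!mulrA -exprSr -exprS.
congr (_ + _); rewrite succnK.
have yx : y2 * x2 ^+ c = (q ^+ c)^-1 *: (x2 ^+ c * y2).
  by rewrite (qcomm_expr c (qcomm_sym q_neq0 xy2)) exprVn.
rewrite yx -scalerAr scalerA; case: c {IHc yx} => [|c].
  by rewrite muln0 !expr0 subrr mul0r scale0r addr0 invr1 mulr1 !mul1r.
rewrite succnK [x2 * (x2 ^+ c * _)]mulrA -exprS -scalerDl; congr (_ *: _); qfield.
Qed.

Lemma y2_x2n c : y2 * x2 ^+ c = q ^- c *: (x2 ^+ c * y2).
Proof. by rewrite (qcomm_expr c (qcomm_sym q_neq0 xy2)) exprVn. Qed.

Lemma y1n_x1 b : y1 ^+ b * x1 = q ^- b *: (x1 * y1 ^+ b).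
Proof. by rewrite (qcomm_exprl b (qcomm_sym q_neq0 xy1)) exprVn. Qed.

(** The left side is the polarized word, block by block. Moving [x2] across [y1 ^+ b] also feeds the
    second monomial, and [[a] * (q ^+ 2 - 1) + 1 = q ^+ (2 * a)] merges its two coefficients. *)
Lemma polar12_mon4 a b c d :
  ([a] *: (x1 ^+ a.-1 * x2) * y1 ^+ b + x1 ^+ a * ([b] *: (y1 ^+ b.-1 * y2))) * (x2 ^+ c * y2 ^+ d)
  = ([a] * q ^+ b) *: mon4 a.-1 b c.+1 d
    + (q ^+ (2 * a) * [b] * q ^- c) *: mon4 a b.-1 c d.+1.
Proof.
have q2 := q2_sub1_neq0 q_not_root1.
rewrite mulrDl -!scalerAr -!scalerAl -!mulrA [x2 * (y1 ^+ b * _)]mulrA x2_y1n.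
rewrite mulrDl mulrDr scalerDr -!scalerAl -!scalerAr !scalerA -!mulrA.
rewrite [x2 * (x2 ^+ c * _)]mulrA -exprS -addrA; congr (_ + _).
rewrite [y2 * (x2 ^+ c * _)]mulrA y2_x2n -!scalerAl -!mulrA -exprS -!scalerAr !scalerA.
case: a => [|a]; first by rewrite qnum0 !mul0r scale0r add0r muln0 /mon4 !expr0 !mul1r.
rewrite succnK [x1 ^+ a * (x1 * _)]mulrA -exprSr -scalerDl; congr (_ *: _).
by rewrite ?qnumE; qfield.
Qed.

(** Here [y1] moves left across [x2 ^+ c], which feeds the first monomial; [[d] * (q ^+ 2 - 1) + 1 =
    q ^+ (2 * d)] merges the coefficients. *)
Lemma polar21_mon4 a b c d :
  x1 ^+ a * (y1 ^+ b * ([c] *: (x1 * x2 ^+ c.-1) * y2 ^+ d + x2 ^+ c * ([d] *: (y1 * y2 ^+ d.-1))))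
  = ([c] * q ^+ (2 * d) / q ^+ b) *: mon4 a.+1 b c.-1 d
    + ([d] * q ^+ c) *: mon4 a b.+1 c d.-1.
Proof.
have q2 := q2_sub1_neq0 q_not_root1.
rewrite !mulrDr -!scalerAr -!scalerAl -!mulrA [x2 ^+ c * (y1 * _)]mulrA x2n_y1.
rewrite mulrDl !mulrDr scalerDr -!scalerAl -!scalerAr !scalerA -!mulrA.
rewrite [y1 ^+ b * (y1 * _)]mulrA -exprSr addrCA addrC; congr (_ + _).
rewrite ![y1 ^+ b * (x1 * _)]mulrA y1n_x1 -!scalerAl -!mulrA -!scalerAr !scalerA.
rewrite ![x1 ^+ a * (x1 * _)]mulrA -exprSr.
case: d => [|d]; first by rewrite qnum0 !mul0r scale0r addr0 muln0 /mon4 expr0 !(mulr1, mul1r).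
rewrite succnK -exprS -scalerDl; congr (_ *: _).
by rewrite ?qnumE; qfield.
Qed.

(** The element (12) rescaled by [q^{1/2}], so that no square root enters the monomial
    computations. *)
Definition det12 : A := x1 * y2 - q *: (y1 * x2).

Lemma det12_x1 : det12 * x1 = q *: (x1 * det12).
Proof.
rewrite mulrBl mulrBr -!mulrA y2x1 -!scalerAl -!scalerAr -!mulrA x2x1 -!scalerAr scalerBr !scalerA.
by rewrite [x1 * (y1 * _)]mulrA xy1 -scalerAl scalerA -!mulrA expr2.
Qed.

Lemma det12_y1 : det12 * y1 = q *: (y1 * det12).
Proof.
rewrite mulrBl mulrBr -!scalerAl -!scalerAr -!mulrA y2y1 x2y1 !mulrDr -!scalerAr !scalerDr !scalerA.
rewrite [y1 * (x1 * _)]mulrA (qcomm_sym q_neq0 xy1) -scalerAl !scalerA -mulrA.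
rewrite scalerN scalerA opprD addrCA addrC.
by rewrite -mulrA -scalerBl; congr (_ *: _ - _); qfield.
Qed.

Lemma det12_mon4 a b c d :
  det12 * mon4 a b c d =
  (q ^+ a * q ^- c) *: mon4 a.+1 b c d.+1 - (q ^+ a * q ^+ b * q) *: mon4 a b.+1 c.+1 d.
Proof.
rewrite /mon4 [LHS]mulrA (qcomm_expr a det12_x1) -scalerAl -[_ * det12 * _]mulrA.
rewrite [det12 * (y1 ^+ b * _)]mulrA.
rewrite (qcomm_expr b det12_y1) -scalerAl -scalerAr scalerA /det12 !mulrBr !mulrBl.
rewrite -!scalerAr -!scalerAl -!mulrA mulrBr -!scalerAr scalerBr scalerA.
rewrite [x2 * (x2 ^+ c * _)]mulrA -exprS [y2 * (x2 ^+ c * _)]mulrA y2_x2n.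
rewrite [y1 ^+ b * (x1 * _)]mulrA y1n_x1 [y1 ^+ b * (y1 * _)]mulrA -exprSr.
rewrite -!scalerAl -!mulrA -!scalerAr !scalerA -exprS [x1 ^+ a * (x1 * _)]mulrA -exprSr.
congr (_ *: _ - _).
qfield.
Qed.

End TwoQuantumPlanes.

(** * Words and PBW monomials *)

Section Words.
Variables (R : realType) (A : algType R[i]%C) (x y : nat -> A).

Lemma evw_cat u v : evw x y (u ++ v) = evw x y u * evw x y v.
Proof. exact: big_cat. Qed.

Lemma evw_nseq n z : evw x y (nseq n z) = ev x y z ^+ n.
Proof.
elim: n => [|n IHn]; first by rewrite /evw big_nil.
by rewrite /evw /= big_cons exprS; congr (_ * _).
Qed.

Lemma Dword_nil k l : Dword x y k l [::] = 0.
Proof. by rewrite /Dword big_ord0. Qed.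

Lemma Dword_cons k l z w :
  Dword x y k l (z :: w) =
  (if z.2 == k then ev x y (z.1, l) * evw x y w else 0) + ev x y z * Dword x y k l w.
Proof.
rewrite /Dword big_mkcond big_ord_recl /=; congr (_ + _).
  by case: eqP => // _; rewrite /evw big_cons.
rewrite mulr_sumr [in RHS]big_mkcond; apply: eq_bigr => i _ /=.
by case: eqP => // _; rewrite /evw big_cons.
Qed.

(** Leibniz rule; it reduces PBW words to blocks of equal letters. *)
Lemma Dword_cat k l u v :
  Dword x y k l (u ++ v) = Dword x y k l u * evw x y v + evw x y u * Dword x y k l v.
Proof.
elim: u => [|z u IHu]; first by rewrite Dword_nil mul0r add0r /evw big_nil mul1r.
rewrite cat_cons !Dword_cons IHu evw_cat mulrDr mulrDl !addrA !mulrA.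
congr (_ + _ + _); last by rewrite /evw big_cons.
by case: ifP => _; rewrite ?mul0r ?mulrA.
Qed.

Lemma Dword_eq0 k l w : (forall z, z \in w -> z.2 != k) -> Dword x y k l w = 0.
Proof.
elim: w => [|z w IHw] hw; first by rewrite Dword_nil.
rewrite Dword_cons (negbTE (hw z _)) ?mem_head // IHw ?mulr0 ?addr0 // => z' z'w.
by apply: hw; rewrite inE z'w orbT.
Qed.

Lemma Dword_nseq_eq0 k l n z : z.2 != k -> Dword x y k l (nseq n z) = 0.
Proof. by move=> zk; apply: Dword_eq0 => z' /nseqP[->]. Qed.

(** Collecting the new letter at the right end costs [q ^+ 2] per letter crossed, and [qnum q n] is
    the resulting geometric sum. The right end suits PBW order when [k < l], the left end in
    [Dword_nseql] when [k > l]. *)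
Lemma Dword_nseqr (q : R[i]%C) k l n b :
  q ^+ 2 - 1 != 0 ->
  ev x y (b, l) * ev x y (b, k) = q ^+ 2 *: (ev x y (b, k) * ev x y (b, l)) ->
  Dword x y k l (nseq n (b, k)) = qnum q n *: (ev x y (b, k) ^+ n.-1 * ev x y (b, l)).
Proof.
move=> q2 comm; elim: n => [|n IHn]; first by rewrite Dword_nil qnum0 scale0r.
rewrite /= Dword_cons /= eqxx IHn evw_nseq (qcomm_expr n comm) -scalerAr mulrA.
rewrite qnumSr // scalerDl -exprM; congr (_ + _).
by case: n {IHn} => [|n]; rewrite ?qnum0 ?scale0r // -exprS.
Qed.

Lemma Dword_nseql (q : R[i]%C) k l n b :
  q ^+ 2 - 1 != 0 ->
  ev x y (b, k) * ev x y (b, l) = q ^+ 2 *: (ev x y (b, l) * ev x y (b, k)) ->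
  Dword x y k l (nseq n (b, k)) = qnum q n *: (ev x y (b, l) * ev x y (b, k) ^+ n.-1).
Proof.
move=> q2 comm; elim: n => [|n IHn]; first by rewrite Dword_nil qnum0 scale0r.
rewrite /= Dword_cons /= eqxx IHn evw_nseq -scalerAr mulrA comm -scalerAl scalerA.
rewrite qnumSl // scalerDl scale1r [qnum q n * _]mulrC; congr (_ + _).
by case: n {IHn} => [|n]; rewrite ?qnum0 ?mulr0 ?scale0r // -[ev x y _ * _ * _]mulrA -exprS.
Qed.

End Words.

(** Groups repeated monomials, as linear independence in [is_H_I] is stated for duplicate-free
    lists. *)
Lemma sum_fibers (K : pzRingType) (V : lmodType K) (I J : eqType) (r : seq I)
    (k : I -> K) (phi : I -> J) (v : J -> V) :
  \sum_(i <- r) k i *: v (phi i)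
  = \sum_(j <- undup (map phi r)) (\sum_(i <- r | phi i == j) k i) *: v j.
Proof.
under [RHS]eq_bigr do rewrite scaler_suml.
rewrite (exchange_big_dep predT) //=; apply: eq_big_seq => i ir.
rewrite (eq_bigl (pred1 (phi i))) => [|j]; last by rewrite /= eq_sym.
by rewrite -big_filter filter_pred1_uniq ?undup_uniq ?mem_undup ?map_f // big_seq1.
Qed.

Lemma seq_argmax (T : eqType) (f : T -> nat) (s : seq T) :
  s = [::] \/ exists2 x, x \in s & forall y, y \in s -> (f y <= f x)%N.
Proof.
elim: s => [|x s IHs]; [by left|right].
case: IHs => [->|[z zs zmax]]; first by exists x => [|y]; rewrite inE // => /eqP ->.
have [xz|zx] := leqP (f x) (f z).
  by exists z => [|y]; rewrite inE ?zs ?orbT // => /orP[/eqP->|/zmax].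
exists x => [|y]; rewrite inE ?eqxx // => /orP[/eqP->//|/zmax yz].
exact: leq_trans yz (ltnW zx).
Qed.

(** * Bihomogeneous elements in the first two planes *)

Section PBW.
Variables (R : realType) (A : algType R[i]%C) (x y : nat -> A) (p : nat).

Definition index1 : 'I_p.+2 := ord0.
Definition index2 : 'I_p.+2 := lift ord0 ord0.

Definition set12 (t : mono p.+2) (a b c d : nat) : mono p.+2 :=
  [ffun i => if i == index1 then (a, b) else if i == index2 then (c, d) else t i].

(** The tail of a PBW word in the letters of index at least 3; it remains a right factor
    throughout. *)
Definition word3 (t : mono p.+2) : seq letter :=
  flatten [seq nseq (t i).1 (true, (i : nat).+1) ++ nseq (t i).2 (false, (i : nat).+1)
          | i <- map (lift ord0 \o lift ord0) (enum 'I_p)].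

Lemma word_set12 t a b c d :
  word (set12 t a b c d) =
  (nseq a (true, 1%N) ++ nseq b (false, 1%N))
  ++ ((nseq c (true, 2%N) ++ nseq d (false, 2%N)) ++ word3 t).
Proof.
rewrite /word enum_ordSl enum_ordSl /= !ffunE /=.
congr (_ ++ (_ ++ flatten _)).
by rewrite -!map_comp; apply: eq_map => i /=; rewrite ffunE.
Qed.

Lemma set12_id t : set12 t (t index1).1 (t index1).2 (t index2).1 (t index2).2 = t.
Proof.
by apply/ffunP => i; rewrite ffunE; do 2?[case: eqP => [->|_]]; rewrite -?surjective_pairing.
Qed.

Lemma word3_index t z : z \in word3 t -> (3 <= z.2)%N.
Proof.
move=> /flatten_mapP[i /mapP[j _ ->]]; rewrite mem_cat /=.
by case/orP => /nseqP[-> _].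
Qed.

Lemma degk1_set12 t a b c d : degk 1 (set12 t a b c d) = (a + b)%N.
Proof.
rewrite /degk word_set12 !count_cat !count_nseq /= !mul1n !mul0n !add0n.
rewrite (@eq_in_count _ _ pred0) ?count_pred0 ?addn0 // => z /word3_index.
by case: z => [? [|[|?]]].
Qed.

Lemma degk2_set12 t a b c d : degk 2 (set12 t a b c d) = (c + d)%N.
Proof.
rewrite /degk word_set12 !count_cat !count_nseq /= !mul1n !mul0n !add0n.
rewrite (@eq_in_count _ _ pred0) ?count_pred0 ?addn0 // => z /word3_index.
by case: z => [? [|[|[|?]]]].
Qed.

Definition mon t a b c d : A := pbw x y (set12 t a b c d).

Lemma monE t a b c d : mon t a b c d = mon4 (x 1) (y 1) (x 2) (y 2) a b c d * evw x y (word3 t).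
Proof.
by rewrite /mon /pbw word_set12 !evw_cat !evw_nseq /ev /= /mon4 !mulrA.
Qed.

(** A list of pairs may repeat a monomial with different coefficients, so that sums become
    concatenations. *)
Lemma bihom12P (g : A) m n :
  bihom12 x y p.+2 g m n <->
  exists2 r : seq (R[i]%C * mono p.+2), g = \sum_(t <- r) t.1 *: pbw x y t.2 &
    forall t, t \in r -> degk 1 t.2 = m /\ degk 2 t.2 = n.
Proof.
split=> [[s [c [-> sdeg]]]|[r -> rdeg]].
  exists [seq (c e, e) | e <- s]; first by rewrite big_map.
  by move=> _ /mapP[e es ->]; exact: sdeg.
exists (undup (map snd r)), (fun e => \sum_(t <- r | t.2 == e) t.1); split.
  exact: (sum_fibers r fst snd).
by move=> e; rewrite mem_undup => /mapP[t tr ->]; exact: rdeg.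
Qed.

Lemma bihom12_0 m n : bihom12 x y p.+2 0 m n.
Proof. by apply/bihom12P; exists [::]; rewrite ?big_nil. Qed.

Lemma bihom12D g h m n :
  bihom12 x y p.+2 g m n -> bihom12 x y p.+2 h m n -> bihom12 x y p.+2 (g + h) m n.
Proof.
move=> /bihom12P[r -> rdeg] /bihom12P[s -> sdeg]; apply/bihom12P.
exists (r ++ s); first by rewrite big_cat.
by move=> t; rewrite mem_cat => /orP[]; [apply: rdeg|apply: sdeg].
Qed.

Lemma bihom12Z k g m n : bihom12 x y p.+2 g m n -> bihom12 x y p.+2 (k *: g) m n.
Proof.
move=> /bihom12P[r -> rdeg]; apply/bihom12P.
exists [seq (k * t.1, t.2) | t <- r].
  by rewrite big_map scaler_sumr; apply: eq_bigr => t _; rewrite scalerA.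
by move=> _ /mapP[t tr ->]; exact: (rdeg t).
Qed.

Lemma bihom12_mon t a b c d m n :
  (a + b)%N = m -> (c + d)%N = n -> bihom12 x y p.+2 (mon t a b c d) m n.
Proof.
move=> <- <-; apply/bihom12P; exists [:: (1, set12 t a b c d)].
  by rewrite big_seq1 scale1r.
by move=> _ /[!inE] /eqP ->; rewrite degk1_set12 degk2_set12.
Qed.

Lemma bihom12_ind m n (P : A -> Prop) :
  P 0 -> (forall g h, P g -> P h -> P (g + h)) -> (forall k g, P g -> P (k *: g)) ->
  (forall t a b c d, (a + b)%N = m -> (c + d)%N = n -> P (mon t a b c d)) ->
  forall g, bihom12 x y p.+2 g m n -> P g.
Proof.
move=> P0 PD PZ Pmon g /bihom12P[r -> rdeg]; rewrite big_seq.
apply: big_ind => // t /rdeg[]; rewrite -(set12_id t.2) degk1_set12 degk2_set12 => mE nE.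
exact/PZ/Pmon.
Qed.

End PBW.

(** * Collecting coefficients in linear combinations *)

Lemma scaler_swap (K : comPzRingType) (V : lmodType K) k l (u : V) :
  k *: (l *: u) = l *: (k *: u).
Proof. by rewrite !scalerA mulrC. Qed.

Section CollectScalars.
Variables (K : comPzRingType) (V : lmodType K) (u v z : V).

(** Here and in the next lemmas [u] is the monomial that occurs twice and whose coefficients are
    merged. *)
Lemma collect_add k1 k2 k3 k4 :
  k1 *: u + k2 *: v + (k3 *: z + k4 *: u) = (k1 + k4) *: u + k2 *: v + k3 *: z.
Proof. by rewrite scalerDl [LHS](AC (2*2) (1*4*2*3)). Qed.

Lemma collect_sub_outer k1 k2 k3 k4 :
  k1 *: u + k2 *: v - (k3 *: z + k4 *: u) = (k1 - k4) *: u + k2 *: v - k3 *: z.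
Proof. by rewrite scalerBl opprD [LHS](AC (2*2) (1*4*2*3)). Qed.

Lemma collect_sub_cross k1 k2 k3 k4 :
  k1 *: u - k2 *: z + (k3 *: v - k4 *: u) = (k1 - k4) *: u + k3 *: v - k2 *: z.
Proof. by rewrite scalerBl [LHS](AC (2*2) (1*4*3*2)). Qed.

Lemma collect_sub_inner k1 k2 k3 k4 :
  k1 *: v + k2 *: u - (k3 *: u + k4 *: z) = (k2 - k3) *: u + k1 *: v - k4 *: z.
Proof. by rewrite scalerBl opprD [LHS](AC (2*2) (2*3*1*4)). Qed.

Lemma collect_add_inner k1 k2 k3 k4 :
  k1 *: v - k2 *: u + (k3 *: u - k4 *: z) = (k3 - k2) *: u + k1 *: v - k4 *: z.
Proof. by rewrite scalerBl [LHS](AC (2*2) (3*2*1*4)). Qed.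

Lemma collect_sub_sum k1 k2 k3 k4 :
  k1 *: u - (k2 *: u + k3 *: v + k4 *: z) = (k1 - k2) *: u - k3 *: v - k4 *: z.
Proof. by rewrite scalerBl !opprD !addrA. Qed.

Lemma collect_sub_sub k1 k2 k3 k4 :
  k1 *: u - k2 *: v - (k3 *: z - k4 *: u) = (k1 + k4) *: u - k2 *: v - k3 *: z.
Proof. by rewrite scalerDl opprB [LHS](AC (2*2) (1*3*2*4)). Qed.

Lemma scale_linear (f : {linear V -> V}) k l : (k * l) *: f u = l *: f (k *: u).
Proof. by rewrite linearZ scalerA mulrC. Qed.

End CollectScalars.

Section IterLinear.
Variables (K : pzRingType) (V : lmodType K) (f : {linear V -> V}).

Lemma iter_linear0 j : iter j f 0 = 0.
Proof. by elim: j => //= j ->; rewrite linear0. Qed.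

Lemma iter_linearZ j k v : iter j f (k *: v) = k *: iter j f v.
Proof. by elim: j => //= j ->; rewrite linearZ. Qed.

End IterLinear.

(** * The series for abstract polarizations *)

Section GordanSeries.
Variables (F : fieldType) (q : F) (A : algType F) (H : nat -> nat -> A -> Prop).
Variables (P12 P21 : {linear A -> A}) (w : A).
Hypothesis q_neq0 : q != 0.
Hypothesis q_not_root1 : forall d : nat, (1 <= d)%N -> q ^+ (2 * d) != 1.

Local Notation "[ n ]" := (qnum q n) (format "[ n ]").

Hypothesis H_0 : forall m n, H m n 0.
Hypothesis H_scale : forall m n k g, H m n g -> H m n (k *: g).
Hypothesis H_P12 : forall m n g, H m.+1 n g -> H m n.+1 (P12 g).
Hypothesis H_P21 : forall m n g, H m n.+1 g -> H m.+1 n (P21 g).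
Hypothesis H_w : forall m n g, H m n g -> H m.+1 n.+1 (w * g).
Hypothesis P12w : forall m n g, H m n g -> [m.+1] *: P12 (w * g) = (q ^+ 2 * [m]) *: (w * P12 g).
Hypothesis P21w : forall m n g, H m n g -> [n.+1] *: P21 (w * g) = [n] *: (w * P21 g).
Hypothesis polar_comm : forall m n g, H m n g ->
  ([m] * [n.+1]) *: P21 (P12 g) - ([n] * [m.+1]) *: P12 (P21 g) = ([m] - [n]) *: g.

Definition qnum_fact n : F := \prod_(i < n) [i.+1].

Lemma qnum_factS n : qnum_fact n.+1 = qnum_fact n * [n.+1].
Proof. exact: big_ord_recr. Qed.

Lemma qnum_fact_neq0 n : qnum_fact n != 0.
Proof. by apply/prodf_neq0 => i _; exact: qnum_neq0. Qed.

(** After division by [[m] * [n]], the summands are the shares of the k-th term of the series that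
    come from [P21 (P12 (b 0))] and from [w * b 1]. *)
Lemma qnum_mulE m n k : (k <= m)%N -> (k <= n)%N ->
  [m] * [n] = q ^+ (2 * k) * [m - k] * [n - k] + [k] * [m + n - k].
Proof.
have q2 := q2_sub1_neq0 q_not_root1.
move=> km kn; rewrite -{1}(subnKC km) -{1}(subnKC kn).
have -> : (m + n - k = k + (m - k) + (n - k))%N by lia.
by move: (m - k)%N (n - k)%N => a b; rewrite !qnumE; qfield.
Qed.

(** Depends on the degrees only through their sum [s], which [P12] preserves; hence the same
    coefficients serve an element and its polarization. *)
Definition gordan_coef s k : F := qnum_fact (s - k.*2).+1 / (qnum_fact k * qnum_fact (s - k).+1).

(** Relates the series of the tail starting at [b 1], of total degree lower by two, to that of the
    whole chain. *)
Lemma gordan_coefS s k : (k <= s)%N ->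
  gordan_coef s k = gordan_coef s.+2 k.+1 * ([k.+1] * [(s.+1 - k).+1]).
Proof.
move=> ks; rewrite /gordan_coef doubleS !subSS subSn // !qnum_factS.
have h1 := qnum_fact_neq0 k; have h2 := qnum_fact_neq0 (s - k).
have h3 : [k.+1] != 0 by exact: qnum_neq0.
have h4 : [(s - k).+1] != 0 by exact: qnum_neq0.
have h5 : [(s - k).+2] != 0 by exact: qnum_neq0.
by field; rewrite h1 h2 h3 h4 h5.
Qed.

(** The recursion of the [b_k], with D and D' expressed by [P12] and [P21]. The vanishing clause
    covers the indices at which [n - k] is truncated. *)
Definition clebsch_chain m n (b : nat -> A) : Prop :=
  [/\ forall k, (k <= m)%N -> (k <= n)%N -> H (m - k) (n - k) (b k),
      forall k, (n < k)%N -> b k = 0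
    & forall k, (k <= m)%N -> (k <= n)%N ->
        ([m - k] * [(n - k).+1]) *: (b k - P21 (P12 (b k))) = w * b k.+1].

Lemma H_iter_P12 m n j g : (j <= m)%N -> H m n g -> H (m - j) (n + j) (iter j P12 g).
Proof.
elim: j => [|j IHj] jm Hg; first by rewrite subn0 addn0.
by rewrite addnS; apply: H_P12; rewrite -subSn // subSS; apply: IHj => //; exact: ltnW.
Qed.

Lemma H_iter_P21 m n j g : (j <= n)%N -> H m n g -> H (m + j) (n - j) (iter j P21 g).
Proof.
elim: j => [|j IHj] jn Hg; first by rewrite subn0 addn0.
by rewrite addnS; apply: H_P21; rewrite -subSn // subSS; apply: IHj => //; exact: ltnW.
Qed.

Lemma H_exp_w m n j g : H m n g -> H (m + j) (n + j) (w ^+ j * g).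
Proof.
move=> Hg; elim: j => [|j IHj]; first by rewrite !addn0 mul1r.
by rewrite !addnS exprS -mulrA; exact: H_w.
Qed.

Lemma P21_exp_w m n j g : H m n g ->
  [n + j] *: P21 (w ^+ j * g) = [n] *: (w ^+ j * P21 g).
Proof.
move=> Hg; elim: j => [|j IHj]; first by rewrite addn0 !mul1r.
by rewrite addnS exprS -!mulrA (P21w (H_exp_w j Hg)) scalerAr IHj -scalerAr.
Qed.

(** Apply [P12] to the recursion: [P12w] moves it past [w] and yields the powers of [q ^+ 2], while
    [polar_comm] restores the order [P21] after [P12]. Division by [[m.+1]] makes the new chain
    start at [P12 (b 0)]. *)
Lemma clebsch_chain_P12 m n b : clebsch_chain m.+1 n b ->
  clebsch_chain m n.+1 (fun k => (q ^+ (2 * k) * [m.+1 - k] / [m.+1]) *: P12 (b k)).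
Proof.
case=> bH b0 bE; split=> [k km kn|k nk|k km kn].
- apply: H_scale; have [kn'|nk] := leqP k n; last by rewrite b0 // linear0; exact: H_0.
  by rewrite subSn //; apply: H_P12; rewrite -subSn //; apply: bH; rewrite // ltnW.
- by rewrite b0 ?linear0 ?scaler0 // ltnW.
have [kn'|nk] := leqP k n; last first.
  rewrite (b0 k) ?(b0 k.+1) ?ltnS ?[(n <= k)%N]ltnW //.
  by rewrite ![P12 0]linear0 !scaler0 [P12 0]linear0 [P21 0]linear0 subr0 scaler0 mulr0.
have bkH : H (m - k).+1 (n - k) (b k) by rewrite -subSn //; apply: bH; rewrite // ltnW.
have := bE k (leqW km) kn'; rewrite subSn // => bkE.
have Pb := polar_comm (H_P12 bkH).
have w_b : [(m - k).+1] *: P12 (w * b k.+1) = (q ^+ 2 * [m - k]) *: (w * P12 (b k.+1)).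
  have [kn''|nk] := ltnP k n; last by rewrite b0 // mulr0 linear0 mulr0 !scaler0.
  by apply: (P12w (n := n - k.+1)); rewrite -subSS; apply: bH.
have m1 : [(m - k).+1] != 0 by exact: qnum_neq0.
have m2 : [m.+1] != 0 by exact: qnum_neq0.
have key : ([m - k] * [(n - k).+2]) *: (P12 (b k) - P21 (P12 (P12 (b k))))
    = (q ^+ 2 * [m - k] / [(m - k).+1]) *: (w * P12 (b k.+1)).
  have -> : (q ^+ 2 * [m - k] / [(m - k).+1]) *: (w * P12 (b k.+1)) = P12 (w * b k.+1).
    apply: (scalerI m1); rewrite w_b scalerA; congr (_ *: _); field; exact: m1.
  rewrite -bkE [P12 (_ *: _)]linearZ /= [P12 (_ - _)]linearB /= !scalerBr.
  move/eqP: Pb; rewrite subr_eq => /eqP ->; rewrite opprD addrA -scalerBl.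
  congr (_ *: _ - _ *: _); last by rewrite mulrC.
  (* The scalars agree since [[a] * [c.+2] - ([a] - [c.+1]) = [a.+1] * [c.+1]]. *)
  have q2 := q2_sub1_neq0 q_not_root1.
  by move: (m - k)%N (n - k)%N => a c; rewrite !qnumE; qfield.
rewrite /= (subSn kn') subSS ![P12 (_ *: _)]linearZ ![P21 (_ *: _)]linearZ /= -scalerBr scaler_swap key.
rewrite -scalerAr scalerA; congr (_ *: _); rewrite mulnS exprD.
field; rewrite m1 m2 //.
Qed.

(** Stated for every chain, since the induction on [m] uses it for the polarized chain and for the
    shifted one. At [m = 0] the single coefficient is 1. *)
Lemma gordan_series m n b : clebsch_chain m n b ->
  b 0 = \sum_(k < m.+1) gordan_coef (m + n) k *:
          (w ^+ k * iter (m - k) P21 (iter (m - k) P12 (b k))).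
Proof.
elim: m n b => [|m IHm] n b chb.
  rewrite big_ord1 /gordan_coef double0 !subn0 mul1r /qnum_fact big_ord0 mul1r divff ?scale1r //.
  exact: qnum_fact_neq0.
have [bH b0 bE] := chb.
have m1 : [m.+1] != 0 by exact: qnum_neq0.
have n1 : [n.+1] != 0 by exact: qnum_neq0.
(* Here b_0 = P21 P12 b_0 + w b_1 / ((m+1)(n+1)), and both summands expand by induction. *)
pose T k := w ^+ k * iter (m.+1 - k) P21 (iter (m.+1 - k) P12 (b k)).
have T0 k : (n < k)%N -> T k = 0.
  move=> nk; rewrite /T b0 //.
  by rewrite !iter_linear0 mulr0.
(* The factor [q ^+ (2 * k) * [m.+1 - k] / [m.+1]] comes from [clebsch_chain_P12], and [[n.+1 - k] /
   [n.+1]] from moving the outer [P21] past [w ^+ k]. The added term [k = m.+1] has coefficient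
   zero. *)
have P21P12b : P21 (P12 (b 0)) = \sum_(k < m.+2)
    (gordan_coef (m.+1 + n) k * (q ^+ (2 * k) * [m.+1 - k] * [n.+1 - k] / ([m.+1] * [n.+1]))) *: T k.
  rewrite big_ord_recr /= subnn qnum0 !(mulr0, mul0r) scale0r addr0.
  have /IHm := clebsch_chain_P12 chb.
  rewrite muln0 subn0 expr0 mul1r divff // scale1r => ->; rewrite linear_sum /=.
  apply: eq_bigr => -[k km] _ /=; rewrite addnS -addSn linearZ /=.
  have [kn|nk] := leqP k n; last first.
    by rewrite T0 // b0 // [P12 0]linear0 scaler0 !iter_linear0 mulr0 [P21 0]linear0 !scaler0.
  rewrite !iter_linearZ -scalerAr linearZ /= -iterSr.
  (* The iterates of [P12] lower the first degree to 0, and those of [P21] raise it again to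
     [m - k]. *)
  have gH : H (m - k) (n.+1 - k) (iter (m - k) P21 (iter (m - k).+1 P12 (b k))).
    have := bH k (ltnW km) kn => /(H_iter_P12 (leqnn _)).
    rewrite subnn subSn // => /(H_iter_P21 (j := m - k)).
    rewrite add0n; have -> : (n - k + (m - k).+1 - (m - k) = n.+1 - k)%N by lia.
    by apply; lia.
  have := P21_exp_w k gH; rewrite subnK ?leqW // => P21E.
  have -> : P21 (w ^+ k * iter (m - k) P21 (iter (m - k).+1 P12 (b k)))
      = ([n.+1 - k] / [n.+1]) *: T k.
    by apply: (scalerI n1); rewrite P21E scalerA mulrCA divff // mulr1 /T (subSn (km : (k <= m)%N)).
  rewrite !scalerA; congr (_ *: _); field; rewrite m1 n1 //.
have wb1 : w * b 1 = \sum_(k < m.+2)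
    (gordan_coef (m.+1 + n) k * ([k] * [m.+1 + n.+1 - k])) *: T k.
  rewrite big_ord_recl /= qnum0 mul0r mulr0 scale0r add0r.
  (* For [n = 0] the degree [n.-1] is truncated, but then all shifted terms are zero. *)
  have /IHm -> : clebsch_chain m n.-1 (fun k => b k.+1).
    split=> [k km kn|k nk|k km kn].
    - have [n0|n_gt0] := posnP n; first by rewrite b0 ?n0 //; exact: H_0.
      have -> : (n.-1 - k = n - k.+1)%N by lia.
      by rewrite -(subSS k m); apply: bH; lia.
    - by apply: b0; lia.
    have [n0|n_gt0] := posnP n; first by rewrite !b0 ?n0 // linear0 linear0 subr0 scaler0 mulr0.
    have := bE k.+1 km; rewrite subSS => <-; last by lia.
    by congr (([_] * [_]) *: _); lia.
  rewrite mulr_sumr; apply: eq_bigr => -[k km] _ /=; rewrite -scalerAr [w * (_ * _)]mulrA -exprS.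
  have [nk|kn] := ltnP n k.+1.
    by rewrite T0 // b0 // !iter_linear0 mulr0 !scaler0.
  rewrite /bump leq0n add1n /T subSS; congr (_ *: _).
  rewrite gordan_coefS; last by lia.
  have -> : ((m + n.-1).+2 = m.+1 + n)%N by lia.
  by have -> : (((m + n.-1).+1 - k).+1 = m.+1 + n.+1 - k.+1)%N by lia.
have := bE 0 isT isT; rewrite !subn0 => bE0.
have -> : b 0 = P21 (P12 (b 0)) + ([m.+1] * [n.+1])^-1 *: (w * b 1).
  by rewrite -bE0 scalerA mulVf ?mulf_neq0 // scale1r addrC subrK.
rewrite P21P12b wb1 scaler_sumr -big_split; apply: eq_bigr => -[k km] _ /=.
have [nk|kn] := ltnP n k; first by rewrite -/(T k) T0 // !scaler0 addr0.
rewrite scalerA -scalerDl; congr (_ *: _).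
(* This identity makes the two coefficients of [T k] add up to [gordan_coef]. *)
have e := @qnum_mulE m.+1 n.+1 k km (leqW kn).
rewrite -[RHS]mulr1 -(divff (mulf_neq0 m1 n1)) {3}e.
field; rewrite m1 n1 //.
Qed.

End GordanSeries.

(** * Symmetric quantum numbers and the coefficients of the series *)

Lemma bin2D a b : 'C(a + b, 2) = ('C(a, 2) + 'C(b, 2) + a * b)%N.
Proof.
elim: a => [|a IHa]; first by rewrite bin0n mul0n addn0.
by rewrite addSn !binS !bin1 IHa; lia.
Qed.

Section BracketNumbers.
Variables (R : realType) (q : R[i]%C).
Hypothesis q_neq0 : q != 0.
Hypothesis q_not_root1 : forall d : nat, (1 <= d)%N -> q ^+ (2 * d) != 1.

Lemma qintE n : qint q n.+1 = qnum q n.+1 / q ^+ n.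
Proof.
have q2 := q2_sub1_neq0 q_not_root1.
have qn0 : q ^+ n != 0 by exact: expf_neq0.
rewrite /qint qnumE; expand_pow; field.
by rewrite q_neq0 q2 qn0.
Qed.

(** The exponents 0, ..., n - 1 supplied by [qintE] add up to a binomial coefficient. *)
Lemma qfactE n : qfact q n = qnum_fact q n / q ^+ 'C(n, 2).
Proof.
elim: n => [|n IHn]; first by rewrite /qfact big_geq // /qnum_fact big_ord0 divr1.
rewrite qnum_factS /qfact big_nat_recr //= -/(qfact q n) IHn qintE binS bin1 exprD.
by rewrite invfM mulrACA.
Qed.

(* The powers of q relating the factorials of [n] and (n) cancel in the coefficients. *)
Lemma bin2_balance k u v :
  ('C(k + u, 2) + 'C(k + v, 2) + 'C((u + v).+1, 2) + k
   = 'C(u, 2) + 'C(v, 2) + 'C(k, 2) + 'C((k + u + v).+1, 2))%N.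
Proof. by rewrite !binS !bin1 !bin2D; lia. Qed.

(** The degrees are written [k + u] and [k + v] to avoid truncated subtraction. The factor after
    [gordan_coef] is the ratio of [b_k] to the k-th iterate of the Omega-process. *)
Lemma gordan_coef_qbinom_add k u v :
  gordan_coef q (k + u + (k + v)) k
    * (q ^+ k * (qnum_fact q (k + u) * qnum_fact q (k + v) / (qnum_fact q u * qnum_fact q v)))
  = qbinom q (k + u) k * qbinom q (k + v) k / qbinom q (k + u + (k + v) - k + 1) k.
Proof.
rewrite /qbinom /gordan_coef !addKn.
have -> : (k + u + (k + v) - k.*2 = u + v)%N by lia.
have -> : (k + u + (k + v) - k + 1 = (k + u + v).+1)%N by lia.
have -> : (k + u + (k + v) - k = k + u + v)%N by lia.
have -> : ((k + u + v).+1 - k = (u + v).+1)%N by lia.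
have balance : q ^+ 'C(k + u, 2) * q ^+ 'C(k + v, 2) * q ^+ 'C((u + v).+1, 2) * q ^+ k
    = q ^+ 'C(u, 2) * q ^+ 'C(v, 2) * q ^+ 'C(k, 2) * q ^+ 'C((k + u + v).+1, 2).
  by rewrite -[LHS]mulrA -!(exprD q) -bin2_balance addnA.
have q_exp_neq0 e : q ^+ e != 0 by exact: expf_neq0.
have fact_neq0 := qnum_fact_neq0 q_not_root1.
(* With [q ^+ k] traded for these powers, the identity holds with all powers and factorials treated
   as independent atoms. *)
have -> : q ^+ k = q ^+ 'C(u, 2) * q ^+ 'C(v, 2) * q ^+ 'C(k, 2) * q ^+ 'C((k + u + v).+1, 2)
    / (q ^+ 'C(k + u, 2) * q ^+ 'C(k + v, 2) * q ^+ 'C((u + v).+1, 2)).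
  by rewrite -balance mulrC mulKf // !mulf_neq0.
rewrite !qfactE.
have f1 := fact_neq0 k; have f2 := fact_neq0 u; have f3 := fact_neq0 v.
have f4 := fact_neq0 (k + u)%N; have f5 := fact_neq0 (k + v)%N.
have f6 := fact_neq0 (u + v).+1; have f7 := fact_neq0 (k + u + v).+1.
have g1 := q_exp_neq0 'C(k, 2); have g2 := q_exp_neq0 'C(u, 2); have g3 := q_exp_neq0 'C(v, 2).
have g4 := q_exp_neq0 'C(k + u, 2); have g5 := q_exp_neq0 'C(k + v, 2).
have g6 := q_exp_neq0 'C((u + v).+1, 2); have g7 := q_exp_neq0 'C((k + u + v).+1, 2).
move: (qnum_fact q k) (qnum_fact q u) (qnum_fact q v) (qnum_fact q (k + u)) (qnum_fact q (k + v))
  (qnum_fact q (u + v).+1) (qnum_fact q (k + u + v).+1) f1 f2 f3 f4 f5 f6 f7.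
move: (q ^+ 'C(k, 2)) (q ^+ 'C(u, 2)) (q ^+ 'C(v, 2)) (q ^+ 'C(k + u, 2)) (q ^+ 'C(k + v, 2))
  (q ^+ 'C((u + v).+1, 2)) (q ^+ 'C((k + u + v).+1, 2)) g1 g2 g3 g4 g5 g6 g7.
move=> {balance q_exp_neq0 fact_neq0} Q1 Q2 Q3 Q4 Q5 Q6 Q7 g1 g2 g3 g4 g5 g6 g7.
move=> F1 F2 F3 F4 F5 F6 F7 f1 f2 f3 f4 f5 f6 f7.
by field; rewrite ?g1 ?g2 ?g3 ?g4 ?g5 ?g6 ?g7 ?f1 ?f2 ?f3 ?f6 ?f7.
Qed.

Lemma gordan_coef_qbinom m n k : (k <= m)%N -> (k <= n)%N ->
  gordan_coef q (m + n) k
    * (q ^+ k * (qnum_fact q m * qnum_fact q n / (qnum_fact q (m - k) * qnum_fact q (n - k))))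
  = qbinom q m k * qbinom q n k / qbinom q (m + n - k + 1) k.
Proof.
by move=> km kn; have := gordan_coef_qbinom_add k (m - k) (n - k); rewrite !subnKC.
Qed.

End BracketNumbers.

(** * Polarizations and the Omega-process on H_I *)

Section PolarizationOnHI.
Variables (R : realType) (q qh : R[i]%C) (A : algType R[i]%C) (x y : nat -> A) (p : nat).
Variables (P12 P21 : {linear A -> A}).
Hypothesis q_neq0 : q != 0.
Hypothesis q_not_root1 : forall d : nat, (1 <= d)%N -> q ^+ (2 * d) != 1.
Hypothesis qhE : qh ^+ 2 = q.
Hypothesis HI : is_H_I q x y p.+2.
Hypothesis P12E : is_P q x y p.+2 1 2 P12.
Hypothesis P21E : is_P q x y p.+2 2 1 P21.

Local Notation "[ n ]" := (qnum q n) (format "[ n ]").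
Local Notation mon := (@mon R A x y p).
Local Notation bihom := (bihom12 x y p.+2).
Local Notation w := (w12 x y qh).
Local Notation det := (det12 q (x 1) (y 1) (x 2) (y 2)).

Lemma relations12 :
  [/\ x 1 * y 1 = q *: (y 1 * x 1), x 2 * y 2 = q *: (y 2 * x 2)
    & [/\ x 2 * x 1 = q ^+ 2 *: (x 1 * x 2), y 2 * y 1 = q ^+ 2 *: (y 1 * y 2),
          x 2 * y 1 = q *: (y 1 * x 2) + (q ^+ 2 - 1) *: (x 1 * y 2)
        & y 2 * x 1 = q *: (x 1 * y 2)]].
Proof.
by have [same cross _ _] := HI; split; [exact: same|exact: same|exact: (cross 1 2)].
Qed.

Lemma pbw_free (I : eqType) (r : seq I) (k : I -> R[i]%C) (phi : I -> mono p.+2) :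
  \sum_(i <- r) k i *: pbw x y (phi i) = 0 ->
  forall e, \sum_(i <- r | phi i == e) k i = 0.
Proof.
have [_ _ _ free] := HI; rewrite sum_fibers => /(free _ _ (undup_uniq _)) coef0 e.
have [er|er] := boolP (e \in undup (map phi r)); first exact: coef0.
rewrite big_seq_cond big1 // => i /andP[ir /eqP ie].
by case/negP: er; rewrite mem_undup -ie map_f.
Qed.

(** [Omega12] refers to some bidegree of its argument; this makes that bidegree unique when the
    argument is nonzero. *)
Lemma bihom12_degree (g : A) m n m' n' :
  bihom g m n -> bihom g m' n' -> g != 0 -> m = m' /\ n = n'.
Proof.
move=> /bihom12P[r gr rdeg] /bihom12P[s gs sdeg] g_neq0.
have [/andP[/eqP-> /eqP->] //|/nandP mn] := boolP ((m == m') && (n == n')).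
case/negP: g_neq0; rewrite gr (sum_fibers r fst snd).
(* In the difference of the two expansions, no monomial of [r] meets one of [s], the bidegrees being
   distinct. *)
have /pbw_free coef0 :
    \sum_(t <- r ++ [seq (- t.1, t.2) | t <- s]) t.1 *: pbw x y t.2 = 0.
  rewrite big_cat big_map /= -gr [X in _ + X](eq_bigr (fun t => - (t.1 *: pbw x y t.2))).
    by rewrite sumrN -gs subrr.
  by move=> t _; rewrite scaleNr.
apply/eqP/big1_seq => e /andP[_]; rewrite mem_undup => /mapP[t tr te].
have := coef0 e; rewrite big_cat big_map /= [X in _ + X]big1_seq ?addr0 => [->|]; first by rewrite scale0r.
move=> t' /andP[/eqP t'e t's]; have [E1 E2] := rdeg t tr; have [E3 E4] := sdeg t' t's.
by move: mn; rewrite -E1 -E2 -E3 -E4 t'e te !eqxx => -[].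
Qed.

Lemma qh_neq0 : qh != 0.
Proof. by move: q_neq0; rewrite -qhE sqrf_eq0. Qed.

(** * Action of (12) and of the polarizations on PBW monomials *)

Lemma w12E : w = qh^-1 *: det.
Proof.
by rewrite /w12 /det12 scalerBr scalerA -qhE expr2 mulrA mulVf ?qh_neq0 // mul1r.
Qed.

Lemma det_mon t a b c d :
  det * mon t a b c d =
  (q ^+ a * q ^- c) *: mon t a.+1 b c d.+1 - (q ^+ a * q ^+ b * q) *: mon t a b.+1 c.+1 d.
Proof.
have [xy1 xy2 [x2x1 y2y1 x2y1 y2x1]] := relations12.
by rewrite !monE mulrA det12_mon4 // mulrBl -!scalerAl.
Qed.

Lemma polar12_mon t a b c d :
  [a + b] *: P12 (mon t a b c d) =
  ([a] * q ^+ b) *: mon t a.-1 b c.+1 d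
  + (q ^+ (2 * a) * [b] * q ^- c) *: mon t a b.-1 c d.+1.
Proof.
have [xy1 xy2 [x2x1 y2y1 x2y1 y2x1]] := relations12.
have q2 := q2_sub1_neq0 q_not_root1.
have polar := polar12_mon4 q_neq0 q_not_root1 xy1 xy2 y2y1 x2y1 a b c d.
have := congr1 (fun v => v * evw x y (word3 t)) polar.
rewrite [in RHS]mulrDl -![_ *: mon4 _ _ _ _ _ _ _ _ * _]scalerAl -!monE => <-.
rewrite /mon P12E degk1_set12 -[qpar _ _]qnumE.
(* In degree 0 the number [[0]] cannot be cancelled, but both sides vanish. *)
have [/eqP|ab] := posnP (a + b).
  by rewrite addn_eq0 => /andP[/eqP-> /eqP->]; rewrite !qnum0 !(scale0r, mul0r, mulr0, addr0).
rewrite scalerA divff ?qnum_neq0 // scale1r word_set12.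
rewrite !Dword_cat (Dword_nseqr _ (q := q)) // (Dword_nseqr _ (q := q)) //.
rewrite !Dword_nseq_eq0 // [Dword _ _ _ _ (word3 _)]Dword_eq0 => [|z /word3_index]; last first.
  by case: z => [? [|[|?]]].
by rewrite !evw_cat !evw_nseq /ev /= !(mulr0, mul0r, addr0) mulrA.
Qed.

Lemma polar21_mon t a b c d :
  [c + d] *: P21 (mon t a b c d) =
  ([c] * q ^+ (2 * d) / q ^+ b) *: mon t a.+1 b c.-1 d
  + ([d] * q ^+ c) *: mon t a b.+1 c d.-1.
Proof.
have [xy1 xy2 [x2x1 y2y1 x2y1 y2x1]] := relations12.
have q2 := q2_sub1_neq0 q_not_root1.
have polar := polar21_mon4 q_neq0 q_not_root1 xy1 xy2 x2x1 x2y1 a b c d.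
have := congr1 (fun v => v * evw x y (word3 t)) polar.
rewrite [in RHS]mulrDl -![_ *: mon4 _ _ _ _ _ _ _ _ * _]scalerAl -!monE => <-.
rewrite /mon P21E degk2_set12 -[qpar _ _]qnumE.
have [/eqP|cd] := posnP (c + d).
  by rewrite addn_eq0 => /andP[/eqP-> /eqP->]; rewrite !qnum0 !(scale0r, mul0r, mulr0, addr0).
rewrite scalerA divff ?qnum_neq0 // scale1r word_set12.
rewrite !Dword_cat (Dword_nseql _ (q := q)) // (Dword_nseql _ (q := q)) //.
rewrite !Dword_nseq_eq0 // [Dword _ _ _ _ (word3 _)]Dword_eq0 => [|z /word3_index]; last first.
  by case: z => [? [|[|[|?]]]].
by rewrite !evw_cat !evw_nseq /ev /= !(mulr0, mul0r, addr0, add0r) !mulrA.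
Qed.

(* Left multiplication by w sends a PBW monomial whose exponent of x_1 is maximal to a multiple
   of the monomial with exponents of x_1 and y_2 raised by one, which cannot be cancelled. *)
Lemma w12_inj (a : A) : w * a = 0 -> a = 0.
Proof.
rewrite w12E -scalerAl => /eqP; rewrite scaler_eq0 invr_eq0 (negbTE qh_neq0) /= => /eqP det0.
have [_ _ span _] := HI; have [s [c ac]] := span a.
(* Repeated monomials are merged and zero coefficients dropped, so the maximal monomial really
   occurs. *)
pose r := undup s; pose k e := \sum_(e' <- s | e' == e) c e'.
have {ac} aE : a = \sum_(e <- r | k e != 0) k e *: pbw x y e.
  rewrite ac (sum_fibers s c id) map_id [RHS]big_mkcond; apply: eq_bigr => e _.
  rewrite -[\sum_(_ <- s | _) _]/(k e).
  by have [->|//] := eqVneq (k e) 0; rewrite scale0r.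
move: aE; rewrite -big_filter; set r' := filter _ _ => aE.
have r'uniq : uniq r' by rewrite filter_uniq ?undup_uniq.
have [r'0|[e0 e0r' e0max]] := seq_argmax (fun e : mono p.+2 => (e (index1 p)).1) r'.
  by rewrite aE r'0 big_nil.
pose up1 (e : mono p.+2) :=
  set12 e (e (index1 p)).1.+1 (e (index1 p)).2 (e (index2 p)).1 (e (index2 p)).2.+1.
pose up2 (e : mono p.+2) :=
  set12 e (e (index1 p)).1 (e (index1 p)).2.+1 (e (index2 p)).1.+1 (e (index2 p)).2.
pose alpha (e : mono p.+2) := q ^+ (e (index1 p)).1 * q ^- (e (index2 p)).1.
pose beta (e : mono p.+2) := q ^+ (e (index1 p)).1 * q ^+ (e (index1 p)).2 * q.
have /pbw_free/(_ (up1 e0)) :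
    \sum_(t <- [seq (k e * alpha e, up1 e) | e <- r'] ++ [seq (- (k e * beta e), up2 e) | e <- r'])
      t.1 *: pbw x y t.2 = 0.
  rewrite big_cat !big_map /= -big_split -[RHS]det0 aE mulr_sumr; apply: eq_bigr => e _ /=.
  rewrite -scalerAr -[e in RHS](set12_id e) -[pbw _ _ _ in RHS]/(mon e _ _ _ _) det_mon.
  by rewrite scalerBr !scalerA scaleNr set12_id.
rewrite big_cat !big_map /=.
(* [up2] keeps the exponent of [x 1], which thus stays below that of [up1 e0]. *)
rewrite [X in _ + X]big1_seq => [|e /andP[/eqP/ffunP/(_ (index1 p))]]; last first.
  by rewrite !ffunE /= => -[E1 _] /e0max; rewrite E1 ltnn.
rewrite addr0 (eq_bigl (pred1 e0)) => [|e]; last first.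
  rewrite /=; apply/idP/idP => [/eqP upE|/eqP-> //].
  have E i := congr1 (fun t : mono p.+2 => t i) upE.
  apply/eqP/ffunP => i; have := E i; rewrite !ffunE.
  have [->|_] := eqVneq i (index1 p).
    by case=> E1 E2; rewrite [LHS]surjective_pairing E1 E2 -surjective_pairing.
  have [->|//] := eqVneq i (index2 p).
  by case=> E1 E2; rewrite [LHS]surjective_pairing E1 E2 -surjective_pairing.
rewrite -big_filter filter_pred1_uniq // big_seq1 => coef0.
have : k e0 * alpha e0 != 0.
  move: e0r'; rewrite mem_filter => /andP[k0 _].
  by rewrite mulf_neq0 // mulf_neq0 // ?invr_eq0 expf_neq0.
by rewrite coef0 eqxx.
Qed.

(** At exponent 0 truncation would change the monomial, so the coefficient has to vanish there. *)
Lemma mon_predK1 k t a b c d : (a = 0 -> k = 0) -> k *: mon t a.-1.+1 b c d = k *: mon t a b c d.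
Proof. by case: a => // ->; rewrite // !scale0r. Qed.

Lemma mon_predK2 k t a b c d : (b = 0 -> k = 0) -> k *: mon t a b.-1.+1 c d = k *: mon t a b c d.
Proof. by case: b => // ->; rewrite // !scale0r. Qed.

Lemma mon_predK3 k t a b c d : (c = 0 -> k = 0) -> k *: mon t a b c.-1.+1 d = k *: mon t a b c d.
Proof. by case: c => // ->; rewrite // !scale0r. Qed.

Lemma mon_predK4 k t a b c d : (d = 0 -> k = 0) -> k *: mon t a b c d.-1.+1 = k *: mon t a b c d.
Proof. by case: d => // ->; rewrite // !scale0r. Qed.

(** Four monomials arise, two of them equal to the original one; these form the diagonal term. *)
Lemma P21_P12_mon t a b c d :
  ([a + b] * [(c + d).+1]) *: P21 (P12 (mon t a b c d)) =
  ([a] * [c.+1] * q ^+ (2 * d) + q ^+ (2 * a) * [b] * [d.+1]) *: mon t a b c d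
  + ([a] * [d] * (q ^+ b * q ^+ c.+1)) *: mon t a.-1 b.+1 c.+1 d.-1
  + ([b] * [c] * (q ^+ (2 * a + 2 * d + 3) / (q ^+ b * q ^+ c))) *: mon t a.+1 b.-1 c.-1 d.+1.
Proof.
rewrite scale_linear polar12_mon linearD !linearZ /= scalerDr !scalerA.
rewrite ![[(c + d).+1] * _]mulrC -!scalerA.
have := polar21_mon t a.-1 b c.+1 d; rewrite addSn => ->.
have := polar21_mon t a b.-1 c d.+1; rewrite addnS => ->.
rewrite !scalerDr !scalerA !succnK mon_predK1 => [|->]; last by rewrite qnum0 !mul0r.
rewrite [X in _ + (_ + X)]mon_predK2 => [|->]; last by rewrite qnum0 mulr0 !mul0r.
rewrite collect_add; congr (_ *: _ + _ *: _ + _ *: _); try by qfield.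
(* Isolating [[b] / q ^+ b.-1] lets [qnum_divX_pred] remove the truncated exponent. *)
have -> : q ^+ (2 * a) * [b] / q ^+ c * ([c] * q ^+ (2 * d.+1) / q ^+ b.-1)
  = q ^+ (2 * a) / q ^+ c * ([c] * q ^+ (2 * d.+1)) * ([b] / q ^+ b.-1) by ring.
by rewrite qnum_divX_pred //; qfield.
Qed.

(** The off-diagonal terms are those of [P21_P12_mon], so they cancel in the commutator. *)
Lemma P12_P21_mon t a b c d :
  ([c + d] * [(a + b).+1]) *: P12 (P21 (mon t a b c d)) =
  ([a.+1] * [c] * q ^+ (2 * d) + q ^+ (2 * a) * [b.+1] * [d]) *: mon t a b c d
  + ([a] * [d] * (q ^+ b * q ^+ c.+1)) *: mon t a.-1 b.+1 c.+1 d.-1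
  + ([b] * [c] * (q ^+ (2 * a + 2 * d + 3) / (q ^+ b * q ^+ c))) *: mon t a.+1 b.-1 c.-1 d.+1.
Proof.
rewrite scale_linear polar21_mon linearD !linearZ /= scalerDr !scalerA.
rewrite ![[(a + b).+1] * _]mulrC -!scalerA.
have := polar12_mon t a.+1 b c.-1 d; rewrite addSn => ->.
have := polar12_mon t a b.+1 c d.-1; rewrite addnS => ->.
rewrite !scalerDr !scalerA !succnK mon_predK3 => [|->]; last by rewrite qnum0 !mul0r.
rewrite [X in _ + (_ + X)]mon_predK4 => [|->]; last by rewrite qnum0 !mul0r.
rewrite collect_add addrAC; congr (_ *: _ + _ *: _ + _ *: _); try by qfield.
have -> : [c] * q ^+ (2 * d) / q ^+ b * (q ^+ (2 * a.+1) * [b] / q ^+ c.-1)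
  = q ^+ (2 * d) / q ^+ b * (q ^+ (2 * a.+1) * [b]) * ([c] / q ^+ c.-1) by ring.
by rewrite qnum_divX_pred //; qfield.
Qed.

(** On monomials only the diagonal terms survive, with difference [q ^+ (2 * d) * ([a] - [c]) + q ^+
    (2 * a) * ([b] - [d])], that is [[a + b] - [c + d]]. *)
Lemma polar_commutator (g : A) m n : bihom g m n ->
  ([m] * [n.+1]) *: P21 (P12 g) - ([n] * [m.+1]) *: P12 (P21 g) = ([m] - [n]) *: g.
Proof.
move: g; apply: bihom12_ind => [|g h gE hE|k g gE|t a b c d <- <-].
- by rewrite !(linear0, scaler0, addr0).
- by rewrite !(linearD, scalerDr) /= addrACA gE hE.
- rewrite [P12 (k *: g)]linearZ [P21 (k *: g)]linearZ /= [P12 (k *: _)]linearZ [P21 (k *: _)]linearZ /=.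
  by rewrite !(scaler_swap _ k) -scalerBr gE.
rewrite P21_P12_mon P12_P21_mon opprD addrACA subrr addr0 opprD addrACA subrr addr0 -scalerBl.
have q2 := q2_sub1_neq0 q_not_root1.
by congr (_ *: _); rewrite !qnumE; qfield.
Qed.

(** This is D w = q^2 w D; the factor [[m.+1]] reflects the first degree of [w * g]. On a monomial
    both sides reduce to the same three monomials. *)
Lemma P12_w (g : A) m n : bihom g m n ->
  [m.+1] *: P12 (w * g) = (q ^+ 2 * [m]) *: (w * P12 g).
Proof.
have q2 := q2_sub1_neq0 q_not_root1.
move: g; apply: bihom12_ind => [|g h gE hE|k g gE|t a b c d <- _].
- by rewrite !(linear0, mulr0, scaler0).
- by rewrite !(linearD, mulrDr, scalerDr) /= gE hE.
- rewrite -scalerAr ![P12 (k *: _)]linearZ /= -scalerAr.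
  by rewrite !(scaler_swap _ k) gE.
rewrite w12E -![_ *: det * _]scalerAl linearZ /= !(scaler_swap _ qh^-1); congr (_ *: _).
rewrite det_mon linearB /= ![P12 (_ *: _)]linearZ /= scalerBr !(scaler_swap [(a + b).+1]).
have := polar12_mon t a.+1 b c d.+1; rewrite addSn => ->.
have := polar12_mon t a b.+1 c.+1 d; rewrite addnS => ->.
rewrite -[RHS]scalerA [[a + b] *: (det * _)]scalerAr polar12_mon mulrDr.
rewrite -!scalerAr !det_mon !scalerDr !scalerN !scalerA !succnK.
rewrite mon_predK1 => [|->]; last by rewrite qnum0 !(mulr0, mul0r).
rewrite [X in _ = _ + (_ - X)]mon_predK2 => [|->]; last by rewrite qnum0 !(mulr0, mul0r).
rewrite collect_sub_outer collect_sub_cross; congr (_ *: _ + _ *: _ - _ *: _).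
- by case: a => [|a]; case: b => [|b]; rewrite ?qnum0 ?succnK !qnumE; qfield.
- qfield.
- by case: a => [|a]; rewrite ?qnum0 ?succnK; qfield.
Qed.

Lemma P21_w (g : A) m n : bihom g m n ->
  [n.+1] *: P21 (w * g) = [n] *: (w * P21 g).
Proof.
have q2 := q2_sub1_neq0 q_not_root1.
move: g; apply: bihom12_ind => [|g h gE hE|k g gE|t a b c d _ <-].
- by rewrite !(linear0, mulr0, scaler0).
- by rewrite !(linearD, mulrDr, scalerDr) /= gE hE.
- rewrite -scalerAr ![P21 (k *: _)]linearZ /= -scalerAr.
  by rewrite !(scaler_swap _ k) gE.
rewrite w12E -![_ *: det * _]scalerAl linearZ /= !(scaler_swap _ qh^-1); congr (_ *: _).
rewrite det_mon linearB /= ![P21 (_ *: _)]linearZ /= scalerBr !(scaler_swap [(c + d).+1]).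
have := polar21_mon t a.+1 b c d.+1; rewrite addnS => ->.
have := polar21_mon t a b.+1 c.+1 d; rewrite addSn => ->.
rewrite [[c + d] *: (det * _)]scalerAr polar21_mon mulrDr.
rewrite -!scalerAr !det_mon !scalerDr !scalerN !scalerA !succnK.
rewrite [X in _ = _ - X + _]mon_predK3 => [|->]; last by rewrite qnum0 !(mulr0, mul0r).
rewrite [X in _ = _ + (X - _)]mon_predK4 => [|->]; last by rewrite qnum0 !(mulr0, mul0r).
rewrite collect_sub_inner collect_add_inner; congr (_ *: _ + _ *: _ - _ *: _).
- by rewrite !qnumE; qfield.
- by case: c => [|c]; rewrite ?qnum0 ?succnK; qfield.
- qfield.
Qed.

(** The off-diagonal monomials of [P21_P12_mon] are those that [det12] produces from monomials with
    two exponents lowered, which yields the quotient of the Omega-process. *)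
Lemma exists_w12_quotient (g : A) m n : bihom g m.+1 n.+1 ->
  exists2 b, bihom b m n & ([m.+1] * [n.+2]) *: (g - P21 (P12 g)) = w * b.
Proof.
have q2 := q2_sub1_neq0 q_not_root1.
move: g; apply: bihom12_ind => [|g h [b bH bE] [b' b'H b'E]|k g [b bH bE]|t a b c d abE cdE].
- by exists 0; [exact: bihom12_0|rewrite !(linear0, mulr0, scaler0, addr0)].
- exists (b + b'); first exact: bihom12D.
  by rewrite mulrDr -bE -b'E -scalerDr; congr (_ *: _); rewrite !linearD /= addrACA.
- exists (k *: b); first exact: bihom12Z.
  rewrite -scalerAr -bE scaler_swap; congr (_ *: _).
  by rewrite scalerBr [P12 (k *: _)]linearZ [P21 (k *: _)]linearZ.
(* Comparing the two off-diagonal terms of [P21_P12_mon] with [det_mon] forces the coefficients. *)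
exists (qh *: (([a] * [d] * (q ^+ c.+1 / q ^+ a)) *: mon t a.-1 b c d.-1
    - ([b] * [c] * (q ^+ (a + 2 * d + 2) / q ^+ b)) *: mon t a b.-1 c.-1 d)).
  apply: bihom12Z; rewrite -scaleNr; apply: bihom12D.
    case: a d abE cdE => [|a] [|d] abE cdE; rewrite ?qnum0 ?(mulr0, mul0r) ?scale0r;
      try exact: bihom12_0.
    by apply/bihom12Z/bihom12_mon; lia.
  case: b c abE cdE => [|b] [|c] abE cdE; rewrite ?qnum0 ?(mulr0, mul0r) ?oppr0 ?scale0r;
    try exact: bihom12_0.
  by apply/bihom12Z/bihom12_mon; lia.
rewrite scalerBr -abE -cdE P21_P12_mon abE cdE w12E -[RHS]scalerAr -[qh^-1 *: det * _]scalerAl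
  [RHS]scalerA divff ?qh_neq0 // scale1r.
rewrite mulrBr -![det * (_ *: _)]scalerAr !det_mon !scalerBr !scalerA.
rewrite [X in _ = X - _ - _]mon_predK1 => [|->]; last by rewrite qnum0 !(mulr0, mul0r).
rewrite [X in _ = X - _ - _]mon_predK4 => [|->]; last by rewrite qnum0 !(mulr0, mul0r).
rewrite [X in _ = _ - (_ - X)]mon_predK2 => [|->]; last by rewrite qnum0 !(mulr0, mul0r).
rewrite [X in _ = _ - (_ - X)]mon_predK3 => [|->]; last by rewrite qnum0 !(mulr0, mul0r).
rewrite collect_sub_sum collect_sub_sub; congr (_ *: _ - _ *: _ - _ *: _).
- rewrite -abE -cdE {abE cdE}.
  by case: a => [|a]; case: b => [|b]; rewrite ?qnum0 ?succnK !qnumE; qfield.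
- by case: (a) => [|?]; rewrite ?qnum0 ?succnK; qfield.
- by case: (c) => [|?]; rewrite ?qnum0 ?succnK; qfield.
Qed.

Lemma bihom_P12 (g : A) m n : bihom g m.+1 n -> bihom (P12 g) m n.+1.
Proof.
(* [polar12_mon] describes [[m.+1] *: P12 g], so this nonzero factor is introduced first. *)
move=> gH; rewrite -[P12 g]scale1r -(mulVf (qnum_neq0 q_not_root1 (ltn0Sn m))) -scalerA.
apply: bihom12Z; move: g gH; apply: bihom12_ind => [|g h gH hH|k g gH|t a b c d abE cdE].
- by rewrite linear0 scaler0; exact: bihom12_0.
- by rewrite linearD scalerDr; exact: bihom12D.
- by rewrite linearZ scaler_swap; exact: bihom12Z.
rewrite -abE polar12_mon; apply: bihom12D.
  case: a abE => [|a] abE; first by rewrite qnum0 mul0r scale0r; exact: bihom12_0.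
  by apply/bihom12Z/bihom12_mon; lia.
case: b abE => [|b] abE; first by rewrite qnum0 mulr0 mul0r scale0r; exact: bihom12_0.
by apply/bihom12Z/bihom12_mon; lia.
Qed.

Lemma bihom_P21 (g : A) m n : bihom g m n.+1 -> bihom (P21 g) m.+1 n.
Proof.
move=> gH; rewrite -[P21 g]scale1r -(mulVf (qnum_neq0 q_not_root1 (ltn0Sn n))) -scalerA.
apply: bihom12Z; move: g gH; apply: bihom12_ind => [|g h gH hH|k g gH|t a b c d abE cdE].
- by rewrite linear0 scaler0; exact: bihom12_0.
- by rewrite linearD scalerDr; exact: bihom12D.
- by rewrite linearZ scaler_swap; exact: bihom12Z.
rewrite -cdE polar21_mon; apply: bihom12D.
  case: c cdE => [|c] cdE; first by rewrite qnum0 !mul0r scale0r; exact: bihom12_0.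
  by apply/bihom12Z/bihom12_mon; lia.
case: d cdE => [|d] cdE; first by rewrite qnum0 mul0r scale0r; exact: bihom12_0.
by apply/bihom12Z/bihom12_mon; lia.
Qed.

Lemma bihom_w (g : A) m n : bihom g m n -> bihom (w * g) m.+1 n.+1.
Proof.
move: g; apply: bihom12_ind => [|g h gH hH|k g gH|t a b c d abE cdE].
- by rewrite mulr0; exact: bihom12_0.
- by rewrite mulrDr; exact: bihom12D.
- by rewrite -scalerAr; exact: bihom12Z.
rewrite w12E -scalerAl det_mon -scaleNr.
by apply/bihom12Z/bihom12D; apply/bihom12Z/bihom12_mon; lia.
Qed.

(** * The Omega-process and its iterates *)

Local Notation Omega := (Omega12 q x y p.+2 qh P12 P21).

(** [exists_w12_quotient] provides a witness for the choice operator, and injectivity of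
    multiplication by [w] makes the quotient unique. The factor [q] appears because [qint q n.+2 /
    qint q n.+1 = [n.+2] / (q * [n.+1])]. *)
Lemma Omega12_spec (g : A) m n : bihom g m.+1 n.+1 ->
  bihom (Omega g) m n /\
  ([m.+1] * [n.+2]) *: (g - P21 (P12 g)) = (q * [m.+1] * [n.+1]) *: (w * Omega g).
Proof.
move=> gH; have [b bH bE] := exists_w12_quotient gH.
have mn0 : [m.+1] * [n.+2] != 0 by rewrite mulf_neq0 // qnum_neq0.
pose a0 := ([m.+1] * [n.+2])^-1 *: b.
have a0E : g - P21 (P12 g) = w * a0 by apply: (scalerI mn0); rewrite bE -scalerAr scalerA divff ?scale1r.
have a0H : bihom a0 m n by exact: bihom12Z.
clearbody a0; have exOmega : exists h, exists (m' n' : nat) (a : A),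
    [/\ (1 <= m')%N, (1 <= n')%N, bihom g m' n', g = P21 (P12 g) + w * a
      & h = (qint q n'.+1 / qint q n') *: a].
  by exists ((qint q n.+2 / qint q n.+1) *: a0), m.+1, n.+1, a0; rewrite -a0E addrC subrK.
have [m' [n' [a [_ _ gH' gE]]]] := epsilon_spec (inhabits (0 : A)) _ exOmega.
rewrite -/(Omega g) => OmE.
have aE : a = a0.
  have wa : w * a = g - P21 (P12 g) by apply: (addrI (P21 (P12 g))); rewrite -gE addrC subrK.
  by apply/eqP; rewrite -subr_eq0; apply/eqP/w12_inj; rewrite mulrBr wa a0E subrr.
(* The degrees of [g] are determined, and with them the factor [n+1]/[n], only if [g != 0]. *)
have [g0|g0] := eqVneq g 0.
  have a00 : a0 = 0 by apply: w12_inj; rewrite -a0E g0 [P12 0]linear0 [P21 0]linear0 subr0.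
  rewrite OmE aE a00 a0E a00 scaler0 mulr0 !scaler0; split=> //; exact: bihom12_0.
have [m'E n'E] := bihom12_degree gH' gH g0.
rewrite OmE aE n'E; split; first exact: bihom12Z.
rewrite a0E -scalerAr scalerA; congr (_ *: _).
rewrite !qintE // exprS.
have n0 : [n.+1] != 0 by exact: qnum_neq0.
have qn0 : q ^+ n != 0 by exact: expf_neq0.
by field; rewrite n0 qn0 q_neq0.
Qed.

Lemma bihom_iter_Omega (g : A) m n k : (k <= m)%N -> (k <= n)%N ->
  bihom g m n -> bihom (iter k Omega g) (m - k) (n - k).
Proof.
move=> km kn gH; elim: k km kn => [|k IHk] km kn; first by rewrite !subn0.
have := IHk (ltnW km) (ltnW kn); rewrite -(subnSK km) -(subnSK kn).
by case/Omega12_spec.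
Qed.

(** By [Omega12_spec] the step from [k] to [k.+1] contributes [q * [m - k] * [n - k]]; the scalar is
    the product of these factors. *)
Lemma clebsch_chain_Omega (g : A) m n : bihom g m n ->
  clebsch_chain q (fun m n g => bihom g m n) P12 P21 w m n
    (fun k => if (k <= m)%N && (k <= n)%N then
      (q ^+ k * (qnum_fact q m * qnum_fact q n / (qnum_fact q (m - k) * qnum_fact q (n - k))))
        *: iter k Omega g else 0).
Proof.
move=> gH; split=> [k km kn|k nk|k km kn].
- by rewrite km kn; apply/bihom12Z/bihom_iter_Omega.
- by rewrite [(k <= n)%N]leqNgt nk andbF.
rewrite km kn /=; have kH := bihom_iter_Omega km kn gH.
case: ifPn => [/andP[km' kn']|nkmn].
  rewrite -(subnSK km') -(subnSK kn') in kH *; have [_ OmE] := Omega12_spec kH.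
  rewrite [P12 (_ *: _)]linearZ [P21 (_ *: _)]linearZ /= -scalerBr scaler_swap OmE.
  rewrite -scalerAr scalerA !qnum_factS; congr (_ *: _).
  have h1 := qnum_fact_neq0 q_not_root1 (m - k.+1).
  have h2 := qnum_fact_neq0 q_not_root1 (n - k.+1).
  have h3 : [(m - k.+1).+1] != 0 by exact: qnum_neq0.
  have h4 : [(n - k.+1).+1] != 0 by exact: qnum_neq0.
  by rewrite exprS; field; rewrite h1 h2 h3 h4.
(* The next term is 0, so the left side must vanish. If [k = m], the factor [[m - k]] is zero; if
   [k = n], the commutator in second degree 0 gives it. *)
rewrite mulr0; move: nkmn; rewrite negb_and -!leqNgt => /orP[mk|nk].
  have -> : (m - k = 0)%N by lia.
  by rewrite qnum0 mul0r scale0r.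
have n_k : (n - k = 0)%N by lia.
rewrite n_k in kH *; have := polar_commutator kH; rewrite qnum0 mul0r scale0r !subr0.
have -> : [1] = 1 by rewrite qnumE divff // (q2_sub1_neq0 q_not_root1).
rewrite mulr1 => kE.
rewrite [P12 (_ *: _)]linearZ [P21 (_ *: _)]linearZ /= -scalerBr scaler_swap scalerBr kE subrr scaler0.
by [].
Qed.

Lemma gordan_series_HI (g : A) m n : bihom g m n ->
  g = \sum_(0 <= k < m.+1)
        (if (k <= n)%N then
           (qbinom q m k * qbinom q n k / qbinom q (m + n - k + 1) k) *:
           (w ^+ k * iter (m - k) P21 (iter (m - k) P12 (iter k Omega g)))
         else 0).
Proof.
move=> gH; have := @gordan_series _ q A (fun m n g => bihom g m n) P12 P21 w q_neq0 q_not_root1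
  (@bihom12_0 _ _ x y p) (fun m n k g => @bihom12Z _ _ x y p k g m n)
  (fun m n g => @bihom_P12 g m n) (fun m n g => @bihom_P21 g m n) (fun m n g => @bihom_w g m n)
  (fun m n g => @P12_w g m n) (fun m n g => @P21_w g m n) (fun m n g => @polar_commutator g m n)
  m n _ (clebsch_chain_Omega gH).
have fact_neq0 := qnum_fact_neq0 q_not_root1.
rewrite /= !subn0 expr0 mul1r divff ?mulf_neq0 // scale1r => {1}->.
rewrite big_mkord; apply: eq_bigr => -[k /= km] _.
have -> /= : (k <= m)%N by rewrite -ltnS.
case: ifP => kn; last by rewrite !iter_linear0 mulr0 scaler0.
rewrite !iter_linearZ -[w ^+ k * (_ *: _)]scalerAr scalerA; congr (_ *: _).
by rewrite gordan_coef_qbinom // -ltnS.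
Qed.

End PolarizationOnHI.

(** * The expansion of an invariant element *)

Unset Implicit Arguments. Set Strict Implicit. Set Printing Implicit Defensive.

Theorem theorem3p8 (R : realType) (q qh : R[i]%C) (p : nat)
    (A : algType R[i]%C) (x y : nat -> A)
    (E F K Kinv L P12 P21 : {linear A -> A}) (f : A) (n : nat -> nat) :
  `|q| = 1 -> q != 1 -> q != -1 -> q != 'i%C -> q != - 'i%C ->
  qh ^+ 2 = q ->
  (forall d : nat, (1 <= d)%N -> q ^+ (2 * d) != 1) ->
  (2 <= p)%N ->
  is_H_I q x y p ->
  is_Uq_action x y p qh E F K Kinv L ->
  is_P q x y p 1 2 P12 ->
  is_P q x y p 2 1 P21 ->
  is_invariant qh E F K L f ->
  homog x y p f n ->
  f = \sum_(0 <= k < (n 1%N).+1)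
        (if (k <= n 2%N)%N then
           (qbinom q (n 1%N) k * qbinom q (n 2%N) k
              / qbinom q (n 1%N + n 2%N - k + 1) k) *:
           ((w12 x y qh) ^+ k *
              iter (n 1%N - k) P21
                (iter (n 1%N - k) P12
                   (iter k (Omega12 q x y p qh P12 P21) f)))
         else 0).
Proof.
(* Writing the number of planes as [p.+2] makes the indices 1 and 2 available as ordinals. *)
move=> q_norm1 _ _ _ _ qhE q_not_root1; case: p => [//|[//|p]] _ HI _ P12E P21E _ [s [c [fE sdeg]]].
have q_neq0 : q != 0 by rewrite -normr_eq0 q_norm1 oner_neq0.
apply: (gordan_series_HI q_neq0 q_not_root1 qhE HI P12E P21E).
by exists s, c; split=> // e es; split; apply: sdeg.
Qed.
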